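(* Let $\mathbb{F}$ be $\mathbb{R}$ or $\mathbb{C}$, let $n\geqslant 2$, and let $\mathfrak{t}_0(n)$ be the Lie algebra of strictly upper triangular $n\times n$ matrices over $\mathbb{F}$, with basis $e_{ij}$, $1\leqslant i<j\leqslant n$, and commutation relations $[e_{ij},e_{kl}]=\delta_{jk}e_{il}-\delta_{li}e_{kj}$. Then a basis of $\mathrm{Inv}(\mathfrak{t}_0(n))$ is formed by the Casimir operators \[ \det(e_{ij})^{i=1,\ldots,k}_{j=n-k+1,\ldots,n},\qquad k=1,\ldots,\left[\frac n2\right]. \]
   Context: For a finite-dimensional Lie algebra $\mathfrak{g}$ over $\mathbb{F}$ with basis $e_1,\ldots,e_n$, $[e_i,e_j]=c_{ij}^ke_k$, and connected Lie group $G$, let $x_1,\ldots,x_n$ be the coordinates on $\mathfrak{g}^*$ associated with the dual basis. An invariant of the coadjoint action $\mathrm{Ad}^*_G$ (where $\langle \mathrm{Ad}^*_gx,u\rangle=\langle x,\mathrm{Ad}_{g^{-1}}u\rangle$) is a (possibly only locally defined, on a connected open set) smooth (analytic if $\mathbb{F}=\mathbb{C}$) function $F(x_1,\ldots,x_n)$ invariant under $\mathrm{Ad}^*_G$, equivalently $\sum_{j,k}c_{ij}^kx_k\,\partial F/\partial x_j=0$ for all $i$. The maximal number of functionally independent invariants is $N_\mathfrak{g}=\dim\mathfrak{g}-\operatorname{rank}\mathrm{Ad}^*_G$, where $\operatorname{rank}\mathrm{Ad}^*_G=\sup_x\operatorname{rank}(\sum_k c_{ij}^kx_k)_{i,j}$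 is the dimension of the regular orbits. A (functional) basis of invariants is a set of $N_\mathfrak{g}$ functionally independent invariants (every invariant is then locally a function of them). The corresponding elements of $\mathrm{Inv}(\mathfrak{g})$ (generalized Casimir operators; usual Casimir operators, i.e. elements of the center of the universal enveloping algebra, if $F$ is polynomial) are obtained by replacing $x_i$ by $e_i$ and symmetrizing monomials; a basis of $\mathrm{Inv}(\mathfrak{g})$ is the set of symmetrizations of a functional basis of invariants of $\mathrm{Ad}^*_G$. The elements $e_{ij}$ occurring in each of the determinants here commute with one another, so symmetrization is trivial. $[\,\cdot\,]$ applied to $n/2$ denotes the integer part. *)

(* Defs.v *)
From HB Require Import structures.
From mathcomp Require Import all_boot all_order all_algebra perm.
From mathcomp Require Import all_classical all_reals all_analysis.
From mathcomp Require Import complex.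
From mathcomp Require mpoly.
(* Without the notations, which clash with those of all_analysis. *)
Import (canonicals, coercions) mpoly.

Set Implicit Arguments.
Unset Strict Implicit.
Unset Printing Implicit Defensive.

Import Order.TTheory GRing.Theory Num.Theory.
Import numFieldNormedType.Exports.

Local Open Scope classical_set_scope.
Local Open Scope ring_scope.

(* Universal enveloping algebra of the Lie algebra with basis e_0 .. e_(d-1) *)
(* and brackets [e_i, e_j] = \sum_k c i j k e_k: the unital associative      *)
(* K-algebra generated by the e_i subject to these relations, as the         *)
(* quotient of the formal expressions in the e_i by the least congruence     *)
(* that contains the relations and the algebra axioms.                       *)
Section Envelope.
Variables (K : fieldType) (d : nat) (c : 'I_d -> 'I_d -> 'I_d -> K).

Inductive uterm : Type :=
  | UGen of 'I_d
  | UCst of K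
  | UAdd of uterm & uterm
  | UMul of uterm & uterm.

HB.instance Definition _ := gen_eqMixin uterm.
HB.instance Definition _ := gen_choiceMixin uterm.

Inductive ueq : uterm -> uterm -> Prop :=
  | ueq_refl x : ueq x x
  | ueq_sym x y : ueq x y -> ueq y x
  | ueq_trans y x z : ueq x y -> ueq y z -> ueq x z
  | ueq_add x x' y y' : ueq x x' -> ueq y y' -> ueq (UAdd x y) (UAdd x' y')
  | ueq_mul x x' y y' : ueq x x' -> ueq y y' -> ueq (UMul x y) (UMul x' y')
  | ueq_addA x y z : ueq (UAdd x (UAdd y z)) (UAdd (UAdd x y) z)
  | ueq_addC x y : ueq (UAdd x y) (UAdd y x)
  | ueq_add0 x : ueq (UAdd (UCst 0) x) x
  | ueq_addN x : ueq (UAdd (UMul (UCst (-1)) x) x) (UCst 0)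
  | ueq_mulA x y z : ueq (UMul x (UMul y z)) (UMul (UMul x y) z)
  | ueq_mul1 x : ueq (UMul (UCst 1) x) x
  | ueq_mulDl x y z : ueq (UMul (UAdd x y) z) (UAdd (UMul x z) (UMul y z))
  | ueq_mulDr x y z : ueq (UMul x (UAdd y z)) (UAdd (UMul x y) (UMul x z))
  | ueq_cstD a b : ueq (UCst (a + b)) (UAdd (UCst a) (UCst b))
  | ueq_cstM a b : ueq (UCst (a * b)) (UMul (UCst a) (UCst b))
  | ueq_cstC a x : ueq (UMul (UCst a) x) (UMul x (UCst a))
  | ueq_lie i j : ueq (UMul (UGen i) (UGen j))
      (UAdd (UMul (UGen j) (UGen i))
            (\big[UAdd/UCst 0]_(k < d) UMul (UCst (c i j k)) (UGen k))).

Definition ueqb (x y : uterm) : bool := `[< ueq x y >].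

Lemma ueqb_refl : reflexive ueqb.
Proof. by move=> x; apply/asboolP; exact: ueq_refl. Qed.

Lemma ueqb_sym : symmetric ueqb.
Proof. by move=> x y; apply/asboolP/asboolP; exact: ueq_sym. Qed.

Lemma ueqb_trans : transitive ueqb.
Proof.
by move=> y x z /asboolP xy /asboolP yz; apply/asboolP; exact: ueq_trans xy yz.
Qed.

Canonical ueq_equiv := EquivRel ueqb ueqb_refl ueqb_sym ueqb_trans.

Definition uea := {eq_quot ueq_equiv}%qT.

HB.instance Definition _ := Choice.on uea.
HB.instance Definition _ := EqQuotient.on uea.

Definition uproj (t : uterm) : uea := (\pi_uea t)%qT.
Definition urepr (u : uea) : uterm := repr u.

Lemma ureprK u : uproj (urepr u) = u.
Proof. exact: reprK. Qed.

Lemma uprojP x y : uproj x = uproj y <-> ueq x y.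
Proof.
split=> [|xy]; first by move/eqquotP => /asboolP.
by apply/eqquotP/asboolP.
Qed.

Lemma urepr_proj t : ueq (urepr (uproj t)) t.
Proof. by apply/uprojP; rewrite ureprK. Qed.

Definition u0 : uea := uproj (UCst 0).
Definition u1 : uea := uproj (UCst 1).
Definition uadd (u v : uea) := uproj (UAdd (urepr u) (urepr v)).
Definition umul (u v : uea) := uproj (UMul (urepr u) (urepr v)).
Definition uscale (a : K) (u : uea) := uproj (UMul (UCst a) (urepr u)).
Definition uopp (u : uea) := uscale (-1) u.

Lemma uaddE x y : uadd (uproj x) (uproj y) = uproj (UAdd x y).
Proof. by apply/uprojP; apply: ueq_add; exact: urepr_proj. Qed.

Lemma umulE x y : umul (uproj x) (uproj y) = uproj (UMul x y).
Proof. by apply/uprojP; apply: ueq_mul; exact: urepr_proj. Qed.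

Lemma uscaleE a x : uscale a (uproj x) = uproj (UMul (UCst a) x).
Proof. by apply/uprojP; apply: ueq_mul; [exact: ueq_refl|exact: urepr_proj]. Qed.

Lemma uaddA : associative uadd.
Proof.
move=> x y z; rewrite -[x]ureprK -[y]ureprK -[z]ureprK !uaddE.
by apply/uprojP; exact: ueq_addA.
Qed.

Lemma uaddC : commutative uadd.
Proof.
by move=> x y; rewrite -[x]ureprK -[y]ureprK !uaddE; apply/uprojP; exact: ueq_addC.
Qed.

Lemma uadd0 : left_id u0 uadd.
Proof. by move=> x; rewrite -[x]ureprK uaddE; apply/uprojP; exact: ueq_add0. Qed.

Lemma uaddN : left_inverse u0 uopp uadd.
Proof.
move=> x; rewrite -[x]ureprK /uopp uscaleE uaddE.
by apply/uprojP; exact: ueq_addN.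
Qed.

HB.instance Definition _ := GRing.isZmodule.Build uea uaddA uaddC uadd0 uaddN.

Lemma umulA : associative umul.
Proof.
move=> x y z; rewrite -[x]ureprK -[y]ureprK -[z]ureprK !umulE.
by apply/uprojP; exact: ueq_mulA.
Qed.

Lemma umul1 : left_id u1 umul.
Proof. by move=> x; rewrite -[x]ureprK umulE; apply/uprojP; exact: ueq_mul1. Qed.

Lemma umulr1 : right_id u1 umul.
Proof.
move=> x; rewrite -[x]ureprK umulE; apply/uprojP.
by apply: ueq_trans (ueq_mul1 _); apply: ueq_sym; exact: ueq_cstC.
Qed.

Lemma umulDl : left_distributive umul uadd.
Proof.
move=> x y z; rewrite -[x]ureprK -[y]ureprK -[z]ureprK !(umulE, uaddE).
by apply/uprojP; exact: ueq_mulDl.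
Qed.

Lemma umulDr : right_distributive umul uadd.
Proof.
move=> x y z; rewrite -[x]ureprK -[y]ureprK -[z]ureprK !(umulE, uaddE).
by apply/uprojP; exact: ueq_mulDr.
Qed.

Fixpoint uaug (t : uterm) : K :=
  match t with
  | UGen _ => 0
  | UCst a => a
  | UAdd x y => uaug x + uaug y
  | UMul x y => uaug x * uaug y
  end.

Lemma ueq_aug x y : ueq x y -> uaug x = uaug y.
Proof.
elim=> //=.
- by move=> ? ? ? _ -> _ ->.
- by move=> ? ? ? ? _ -> _ ->.
- by move=> ? ? ? ? _ -> _ ->.
- by move=> *; rewrite addrA.
- by move=> *; rewrite addrC.
- by move=> *; rewrite add0r.
- by move=> *; rewrite mulN1r addNr.
- by move=> *; rewrite mulrA.
- by move=> *; rewrite mul1r.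
- by move=> *; rewrite mulrDl.
- by move=> *; rewrite mulrDr.
- by move=> *; rewrite mulrC.
- move=> i j; rewrite mul0r add0r; elim/big_ind: _ => //= [x' y' <- <-|k _].
    by rewrite addr0.
  by rewrite mulr0.
Qed.

Lemma u1_neq0 : u1 != u0.
Proof. by apply/eqP => /uprojP/ueq_aug/eqP; rewrite /= oner_eq0. Qed.

HB.instance Definition _ := GRing.Zmodule_isNzRing.Build uea
  umulA umul1 umulr1 umulDl umulDr u1_neq0.

Lemma uscaleA a b v : uscale a (uscale b v) = uscale (a * b) v.
Proof.
rewrite -[v]ureprK !uscaleE; apply/uprojP.
apply: ueq_trans (ueq_mulA _ _ _) _; apply: ueq_mul; last exact: ueq_refl.
by apply: ueq_sym; exact: ueq_cstM.
Qed.

Lemma uscale1 : left_id 1 uscale.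
Proof. by move=> x; rewrite -[x]ureprK uscaleE; apply/uprojP; exact: ueq_mul1. Qed.

Lemma uscaleDr : right_distributive uscale uadd.
Proof.
move=> a x y; rewrite -[x]ureprK -[y]ureprK !(uscaleE, uaddE).
by apply/uprojP; exact: ueq_mulDr.
Qed.

Lemma uscaleDl v : {morph uscale^~ v : a b / a + b >-> uadd a b}.
Proof.
move=> a b /=; rewrite -[v]ureprK !uscaleE uaddE; apply/uprojP.
apply: ueq_trans (ueq_mulDl _ _ _); apply: ueq_mul; last exact: ueq_refl.
exact: ueq_cstD.
Qed.

HB.instance Definition _ := GRing.Zmodule_isLmodule.Build K uea
  uscaleA uscale1 uscaleDr uscaleDl.

Lemma uscaleAl a (u v : uea) : a *: (u * v) = (a *: u) * v.
Proof.
rewrite -[u]ureprK -[v]ureprK [_ * _]umulE [LHS]uscaleE [a *: _]uscaleE.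
by rewrite [RHS]umulE; apply/uprojP; exact: ueq_mulA.
Qed.

HB.instance Definition _ := GRing.Lmodule_isLalgebra.Build K uea uscaleAl.

Lemma uscaleAr a (u v : uea) : a *: (u * v) = u * (a *: v).
Proof.
rewrite -[u]ureprK -[v]ureprK [_ * _]umulE [LHS]uscaleE [a *: _]uscaleE.
rewrite [RHS]umulE; apply/uprojP; apply: ueq_trans (ueq_mulA _ _ _) _.
apply: ueq_trans (ueq_sym (ueq_mulA _ _ _)).
by apply: ueq_mul (ueq_refl _); exact: ueq_cstC.
Qed.

HB.instance Definition _ := GRing.Lalgebra_isAlgebra.Build K uea uscaleAr.

Definition ugen (i : 'I_d) : uea := uproj (UGen i).

Lemma ugen_lie i j :
  ugen i * ugen j - ugen j * ugen i = \sum_k c i j k *: ugen k.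
Proof.
apply/eqP; rewrite subr_eq addrC; apply/eqP.
rewrite [LHS]umulE [X in X + _]umulE.
have -> : \sum_k c i j k *: ugen k =
    uproj (\big[UAdd/UCst 0]_(k < d) UMul (UCst (c i j k)) (UGen k)).
  elim/big_ind2: _ => // [x x' y y' -> ->|k _]; first exact: uaddE.
  exact: uscaleE.
by rewrite [RHS]uaddE; apply/uprojP; exact: ueq_lie.
Qed.

Definition central (z : uea) : Prop := forall u : uea, u * z = z * u.

(* The indeterminate 'X_i of a polynomial stands for the coordinate x_i on   *)
(* the dual of the Lie algebra.                                              *)
Definition sym_monomial (m : mpoly.multinom d) : uea :=
  let w := flatten [seq nseq (m i) i | i <- enum 'I_d] in
  ((size w)`!%:R : K)^-1 *:
    \sum_(s : 'S_(size w)) \prod_(j < size w) ugen (tnth (in_tuple w) (s j)).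

Definition symmetrize (P : mpoly.mpoly d K) : uea :=
  \sum_(m <- mpoly.msupp P) mpoly.mcoeff m P *: sym_monomial m.

End Envelope.

Section Rank.
Variables (K : fieldType) (d : nat) (c : 'I_d -> 'I_d -> 'I_d -> K).

Definition structure_mx (x : 'rV[K]_d) : 'M[K]_d :=
  \matrix_(i, j) \sum_k c i j k * x 0 k.

Definition coadjoint_rank : nat :=
  \max_(r < d.+1 | `[< exists x, \rank (structure_mx x) = r >]) r.

Definition num_invariants : nat := (d - coadjoint_rank)%N.

End Rank.

Section Functions.
Variables (K : numFieldType) (d : nat).
Implicit Types (U : set 'rV[K]_d) (f : 'rV[K]_d -> K).

Fixpoint Cn (r : nat) U f : Prop :=
  (forall x, U x -> {for x, continuous f}) /\
  match r with
  | 0 => True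
  | s.+1 => forall i : 'I_d,
      (forall x, U x -> derivable f x (delta_mx 0 i)) /\
      Cn s U (fun x => 'D_(delta_mx 0 i) f x)
  end.

Definition smooth_on U f : Prop := forall r, Cn r U f.

(* Around each point of U, f is the sum of a power series whose coefficients *)
(* satisfy a Cauchy estimate, so that the series converges absolutely on the *)
(* polydisc of radius r; its partial sums are taken by total degree.         *)
Definition analytic_on U f : Prop :=
  forall a, U a -> exists (t : mpoly.multinom d -> K) (r M : K),
    [/\ 0 < r,
        forall m, `|t m| * r ^+ mpoly.mdeg m <= M
      & forall h : 'rV[K]_d, `|h| < r ->
          (fun N => \sum_(m : mpoly.bmultinom d N)
                      t (mpoly.bmnm m) * \prod_i h 0 i ^+ (mpoly.bmnm m i))
            @ \oo --> f (a + h)].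

Definition jacobian (m : nat) (F : 'I_m -> 'rV[K]_d -> K) (x : 'rV[K]_d) :
    'M[K]_(m, d) :=
  \matrix_(k, i) 'D_(delta_mx 0 i) (F k) x.

(* The differentials are linearly independent on a dense subset of U: the    *)
(* functions are not dependent on any nonempty open subset of U.             *)
Definition functionally_independent (m : nat) U
    (F : 'I_m -> 'rV[K]_d -> K) : Prop :=
  forall W : set 'rV[K]_d, open W -> W `<=` U -> W !=set0 ->
    exists2 x, W x & \rank (jacobian F x) = m.

End Functions.

Section StrictlyUpper.
Variable n : nat.

Definition t0_index : finType := {p : 'I_n * 'I_n | (p.1 < p.2)%N}.

Definition t0_dim : nat := #|t0_index|.

(* The basis e_ij, i < j, is listed as e_(pos a), a < t0_dim.                *)
Definition pos (a : 'I_t0_dim) : 'I_n * 'I_n :=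
  val (enum_val (A := t0_index) a).

Variable K : numFieldType.

Definition t0_basis (a : 'I_t0_dim) : 'M[K]_n := delta_mx (pos a).1 (pos a).2.

Definition mx_lie (A B : 'M[K]_n) : 'M[K]_n := A *m B - B *m A.

Definition t0_const (a b k : 'I_t0_dim) : K :=
  mx_lie (t0_basis a) (t0_basis b) (pos k).1 (pos k).2.

Definition t0_uea : algType K := uea t0_const.

(* The family v indexed by the basis, as a function of the (0-based) row and *)
(* column: entry v i j is v at e_ij if i < j < n, and 0 otherwise.           *)
Definition entry (T : nmodType) (v : 'I_t0_dim -> T) (i j : nat) : T :=
  \sum_(a | ((pos a).1 == i :> nat) && ((pos a).2 == j :> nat)) v a.

Lemma entryE (T : nmodType) (v : 'I_t0_dim -> T) a :
  entry v (pos a).1 (pos a).2 = v a.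
Proof.
rewrite /entry (bigD1 a) ?eqxx //= big1 ?addr0 // => b /andP[/andP[/eqP h1 /eqP h2]].
case/eqP; apply: enum_val_inj; apply: val_inj.
rewrite -/(pos b) -/(pos a) [LHS]surjective_pairing [RHS]surjective_pairing.
by congr pair; apply: val_inj.
Qed.

Lemma mx_lie_basis a b :
  let: (i, j) := pos a in let: (k, l) := pos b in
  mx_lie (t0_basis a) (t0_basis b) =
    (j == k)%:R *: delta_mx i l - (l == i)%:R *: delta_mx k j.
Proof.
rewrite /mx_lie /t0_basis; case: (pos a) (pos b) => i j [k l] /=.
by rewrite !mul_delta_mx_cond !scaler_nat.
Qed.

Definition pairing (x : 'rV[K]_t0_dim) (u : 'M[K]_n) : K :=
  \sum_a x 0 a * u (pos a).1 (pos a).2.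

(* The connected Lie group of t_0(n); the orbits of the coadjoint action do  *)
(* not depend on the choice of a connected group with this Lie algebra.      *)
Definition unitriangular : set 'M[K]_n :=
  [set g | forall i j : 'I_n, (j <= i)%N -> g i j = (i == j)%:R].

(* <Ad*_g x, u> = <x, Ad_(g^-1) u>, in coordinates.                          *)
Definition coAd (g : 'M[K]_n) (x : 'rV[K]_t0_dim) : 'rV[K]_t0_dim :=
  \row_a pairing x (invmx g *m t0_basis a *m g).

Implicit Types U : set 'rV[K]_t0_dim.

(* For a function defined on U only, invariance is that of the local action: *)
(* f is constant along a connected set A of group elements containing 1 that *)
(* does not move x out of U. For U = setT one may take A = unitriangular.    *)
Definition coAd_invariant U (f : 'rV[K]_t0_dim -> K) : Prop :=
  forall x (A : set 'M[K]_n), connected A -> A `<=` unitriangular -> A 1%:M ->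
    (forall g, A g -> U (coAd g x)) ->
    forall g, A g -> f (coAd g x) = f x.

Variable regular : set 'rV[K]_t0_dim -> ('rV[K]_t0_dim -> K) -> Prop.

Definition invariant_on U (f : 'rV[K]_t0_dim -> K) : Prop :=
  regular U f /\ coAd_invariant U f.

Definition functional_basis (m : nat) U
    (F : 'I_m -> 'rV[K]_t0_dim -> K) : Prop :=
  [/\ open U, connected U & U !=set0] /\
  [/\ m = num_invariants t0_const,
      forall k, invariant_on U (F k)
    & functionally_independent U F].

Definition mpoly_fun (d : nat) (P : mpoly.mpoly d K) (x : 'rV[K]_d) : K :=
  mpoly.meval (fun i => x 0 i) P.

(* A basis of Inv(t_0(n)) consists of the symmetrizations of a functional    *)
(* basis of invariants of Ad*; here these invariants are polynomials, hence  *)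
(* globally defined, and their symmetrizations are Casimir operators.        *)
Definition Casimir_basis (m : nat) (C : 'I_m -> t0_uea) : Prop :=
  (forall k, central (C k)) /\
  exists P : 'I_m -> mpoly.mpoly t0_dim K,
    (forall k, C k = symmetrize t0_const (P k)) /\
    functional_basis setT (fun k => mpoly_fun (P k)).

(* Rows 1, .., k and columns n-k+1, .., n in 1-based numbering. The entries  *)
(* commute with one another when k <= n/2, so the order of the factors in    *)
(* the Leibniz formula of \det over this noncommutative ring is immaterial.  *)
Definition corner_det (k : nat) : t0_uea :=
  \det (\matrix_(i < k, j < k) entry (ugen t0_const) i (n - k + j)).

End StrictlyUpper.

Arguments smooth_on {K d} U f.
Arguments analytic_on {K d} U f.
Arguments Casimir_basis {n K} regular {m} C.

(* Main.v *)
(* Centrality: ad e_ab acts on the corner matrix by replacing one row, or     *)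
(* minus one column, by another one of its rows, or columns.                  *)
(*                                                                            *)
(* Number of invariants: the top right block of m x (n - m) units, m = [n/2], *)
(* spans an abelian subalgebra, so the skew form at any x has an isotropic    *)
(* subspace of dimension m (n - m), hence rank at most dim - m; at the        *)
(* antidiagonal x this form is monomial on the off-antidiagonal units, and    *)
(* the bound is attained.                                                     *)
(*                                                                            *)
(* Invariance: Ad*_g multiplies the corner matrix on both sides by            *)
(* unitriangular matrices.                                                    *)
(*                                                                            *)
(* Independence: with respect to the antidiagonal coordinates the Jacobian is *)
(* triangular, and its diagonal entries are up to sign the preceding corner   *)
(* minors, which do not vanish on a dense open set.                           *)

Require Import Defs.
From mathcomp Require Import all_boot all_order all_algebra perm.
From mathcomp Require Import all_classical all_reals all_analysis.
From mathcomp Require Import complex.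
From mathcomp Require Import zify.
From mathcomp Require mpoly.
Import (canonicals, coercions) mpoly.

Set Implicit Arguments.
Unset Strict Implicit.
Unset Printing Implicit Defensive.

Import Order.TTheory GRing.Theory Num.Theory.
Import numFieldNormedType.Exports.

Local Open Scope classical_set_scope.
Local Open Scope ring_scope.

(** The bracket with a unit e_ab is a derivation. On a corner matrix it replaces row b by row a, or
    column a by minus column b, or it kills every entry. A replaced line repeats another line of the
    corner, so the determinant goes to zero and is central ([central_corner_det]). The corner
    entries commute, so this determinant is the symmetrization of the same minor in the coordinates
    ([symmetrize_corner_poly]).

    It remains to see that the coordinate minors form a functional basis. The group acts on a corner
    block through factors of determinant 1 ([corner_poly_invariant]). The orbit rank is caught
    between the bound from an abelian subalgebra and its value at the antidiagonal point
    ([structure_mx_rank_le], [structure_mx_rank_ge]), which leaves exactly [n./2] invariants. In the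
    antidiagonal coordinates the Jacobian of the minors is triangular, and its diagonal entries are,
    up to sign, the minors of order one less. These are nonzero on a dense set, since a nonzero
    polynomial function vanishes on no nonempty open set ([corner_functionally_independent]). *)

Section NoncommutativeDeterminant.

(** * Leibniz determinants over a noncommutative algebra *)

Lemma perm_commr_prod (A : pzRingType) (T : eqType) (f : T -> A) (s t : seq T) :
  {in s &, forall x y, GRing.comm (f x) (f y)} -> perm_eq s t ->
  \prod_(x <- s) f x = \prod_(x <- t) f x.
Proof.
elim: s t => [|x s IHs] t comm_s eq_st.
  by move: eq_st; rewrite perm_sym => /perm_nilP ->.
have xt : x \in t by rewrite -(perm_mem eq_st) mem_head.
have st y : y \in t -> y \in x :: s by rewrite (perm_mem eq_st).
case/splitPr: xt eq_st st => t1 t2 + st.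
rewrite -[x :: t2]cat1s perm_sym perm_catCA /= perm_cons perm_sym => eq_st.
rewrite big_cons (IHs _ _ eq_st) => [|y z ys zs]; last first.
  by apply: comm_s; rewrite in_cons (ys, zs) orbT.
rewrite !big_cat big_cons /= !mulrA; congr (_ * _).
rewrite [in LHS]big_seq [in RHS]big_seq; apply: commr_prod => y yt.
by apply: comm_s; rewrite ?mem_head// st// mem_cat yt.
Qed.

(** The commutator with [e] is a derivation, and only the factor at [i], which occurs once, may fail
    to commute with [e]: a single term of the product rule survives. *)
Lemma commutator_prod (A : pzRingType) (I : eqType) (e : A) (f : I -> A) i s :
  uniq s -> i \in s -> (forall j, j != i -> GRing.comm e (f j)) ->
  e * \prod_(j <- s) f j - (\prod_(j <- s) f j) * e =
  \prod_(j <- s) (if j == i then e * f j - f j * e else f j).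
Proof.
move=> + + cef; elim: s => [//|x s IHs] /= /andP[xs us]; rewrite in_cons !big_cons.
have [ix _|ix /= si] := eqVneq i x; first subst i.
  rewrite ?eqxx (eq_big_seq f) => [|j js]; last first.
    by case: eqVneq => // jx; rewrite -jx js in xs.
  rewrite mulrBl !mulrA; congr (_ - _); rewrite -!mulrA; congr (_ * _).
  apply/esym; rewrite big_seq; apply: commr_prod => j js; apply: cef.
  by apply: contraNneq xs => <-.
rewrite -IHs// mulrBr !mulrA; congr (_ - _).
by rewrite cef// eq_sym.
Qed.

Variables (K : numFieldType) (A : lalgType K).

Lemma eqr_oppr_eq0 (x : A) : x = - x -> x = 0.
Proof.
move=> /eqP; rewrite -subr_eq0 opprK -mulr2n -scaler_nat scaler_eq0.
by rewrite pnatr_eq0 => /eqP.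
Qed.

(** Composing [s] with the transposition on the column side keeps the order of the factors and flips
    the sign, so the determinant equals its opposite. *)
Lemma eq_col_det0 k (M : 'M[A]_k) j1 j2 :
  j1 != j2 -> (forall i, M i j1 = M i j2) -> \det M = 0.
Proof.
move=> j12 eqM; apply: eqr_oppr_eq0; rewrite /determinant -sumrN.
rewrite [LHS](reindex_inj (mulIg (tperm j1 j2))); apply: eq_bigr => s _ /=.
rewrite odd_permM odd_tperm j12 addbT signrN mulNr; congr (- (_ * _)).
apply: eq_bigr => i _; rewrite permM.
by case: tpermP => [->|->|//]; rewrite eqM.
Qed.

(** The transposition now acts on the rows, which permutes the factors of each Leibniz product;
    commuting entries restore their order. *)
Lemma eq_row_det0 k (M : 'M[A]_k) i1 i2 :
  i1 != i2 -> (forall j, M i1 j = M i2 j) ->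
  (forall i j i' j', GRing.comm (M i j) (M i' j')) -> \det M = 0.
Proof.
move=> i12 eqM commM; apply: eqr_oppr_eq0; rewrite /determinant -sumrN.
pose t := tperm i1 i2.
rewrite [LHS](reindex_inj (mulgI t)); apply: eq_bigr => s _ /=.
rewrite odd_permM odd_tperm i12 addTb signrN mulNr; congr (- (_ * _)).
rewrite (eq_bigr (fun i => M (t i) (s (t i)))) => [|i _]; last first.
  by rewrite permM /t; case: tpermP => [->|->|//]; rewrite ?tpermL ?tpermR eqM.
rewrite -(big_map t xpredT (fun i => M i (s i))).
apply: perm_commr_prod => [i j _ _|]; first exact: commM.
apply: uniq_perm; rewrite ?(map_inj_uniq perm_inj) ?index_enum_uniq//.
by move=> i; rewrite mem_index_enum -(permKV t i) map_f// mem_index_enum.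
Qed.

Lemma comm_det k (M : 'M[A]_k) (e : A) :
  (forall i j, GRing.comm e (M i j)) -> GRing.comm e (\det M).
Proof.
move=> ceM; apply: commr_sum => s _; apply: commrM.
  exact/commrX/commrN1.
by apply: commr_prod => i _.
Qed.

Lemma commutator_det_row k (M : 'M[A]_k) (e : A) i0 :
  (forall i j, i != i0 -> GRing.comm e (M i j)) ->
  e * \det M - \det M * e =
  \det (\matrix_(i, j) if i == i0 then e * M i j - M i j * e else M i j).
Proof.
move=> ceM; rewrite /determinant mulr_sumr mulr_suml -sumrB.
apply: eq_bigr => s _.
rewrite mulrA (commrX _ (commrN1 e)) -!mulrA -mulrBr; congr (_ * _).
rewrite (commutator_prod (i := i0)) ?index_enum_uniq ?mem_index_enum// => [|j].
  by apply: eq_bigr => i _; rewrite mxE.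
exact: ceM.
Qed.

Lemma commutator_det_col k (M : 'M[A]_k) (e : A) j0 :
  (forall i j, j != j0 -> GRing.comm e (M i j)) ->
  e * \det M - \det M * e =
  \det (\matrix_(i, j) if j == j0 then e * M i j - M i j * e else M i j).
Proof.
move=> ceM; rewrite /determinant mulr_sumr mulr_suml -sumrB.
apply: eq_bigr => s _.
rewrite mulrA (commrX _ (commrN1 e)) -!mulrA -mulrBr; congr (_ * _).
(* In the product attached to [s], column [j0] is met in row [s^-1 j0]. *)
rewrite (commutator_prod (i := (s^-1)%g j0)) ?index_enum_uniq ?mem_index_enum//.
  by apply: eq_bigr => i _; rewrite mxE -(inj_eq (@perm_inj _ s) i) permKV.
by move=> j; rewrite -(inj_eq (@perm_inj _ s) j) permKV; apply: ceM.
Qed.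

End NoncommutativeDeterminant.

(** * Commutation in the enveloping algebra and centrality of the corner determinants *)

Section Envelope.

(** The centralizer of [z] is a subalgebra: induction on a term representing [u]. *)
Lemma central_gen (K : fieldType) d (c : 'I_d -> 'I_d -> 'I_d -> K) (z : uea c) :
  (forall i, GRing.comm (ugen c i) z) -> central z.
Proof.
move=> cz u; rewrite -[u]ureprK; elim: (urepr u) => [i|a|x IHx y IHy|x IHx y IHy].
- exact: cz.
- by rewrite -[z]ureprK [LHS]umulE [RHS]umulE; apply/uprojP; exact: ueq_cstC.
- by rewrite -uaddE [LHS]mulrDl IHx IHy -mulrDr.
- by rewrite -umulE -[LHS]mulrA IHy mulrA IHx -mulrA.
Qed.

Variable n : nat.
Implicit Types a b : 'I_(t0_dim n).

Lemma pos_lt a : ((pos a).1 < (pos a).2)%N.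
Proof. exact: (valP (enum_val a)). Qed.

Lemma pos_inj : injective (@pos n).
Proof. by move=> a b /val_inj/enum_val_inj. Qed.

Lemma eq_pos a b :
  (a == b) = ((pos a).1 == (pos b).1 :> nat) && ((pos a).2 == (pos b).2 :> nat).
Proof.
by rewrite -(inj_eq pos_inj) [pos a]surjective_pairing [pos b]surjective_pairing.
Qed.

Lemma ex_pos i j : (i < j < n)%N ->
  exists a : 'I_(t0_dim n), (pos a).1 = i :> nat /\ (pos a).2 = j :> nat.
Proof.
case/andP=> ij jn; pose p : 'I_n * 'I_n := (Ordinal (ltn_trans ij jn), Ordinal jn).
by exists (enum_rank (Sub p ij : t0_index n)); rewrite /pos enum_rankK SubK.
Qed.

Lemma entry_pos (T : nmodType) (v : 'I_(t0_dim n) -> T) a i j :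
  (pos a).1 = i :> nat -> (pos a).2 = j :> nat -> entry v i j = v a.
Proof. by move=> <- <-; exact: entryE. Qed.

(** Rows stay below [k], columns start at [n - k >= k], so every corner position is strictly above
    the diagonal and carries a basis unit. *)
Lemma corner_pos k : (k <= n./2)%N ->
  exists c : 'I_k -> 'I_k -> 'I_(t0_dim n), forall i j,
    (pos (c i j)).1 = i :> nat /\ (pos (c i j)).2 = (n - k + j)%N :> nat.
Proof.
move=> kn.
have /choice[c cP] : forall p : 'I_k * 'I_k, exists a : 'I_(t0_dim n),
    (pos a).1 = p.1 :> nat /\ (pos a).2 = (n - k + p.2)%N :> nat.
  by move=> p; apply: ex_pos; have := ltn_ord p.1; have := ltn_ord p.2; lia.
by exists (fun i j => c (i, j)) => i j; exact: cP.
Qed.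

Variable K : numFieldType.

(** Values in an arbitrary module let one computation serve both the brackets of the generators and
    the structure matrix at a point of the dual. *)
Lemma t0_const_sum (V : lmodType K) (v : 'I_(t0_dim n) -> V) a b :
  \sum_k t0_const K a b k *: v k =
    ((pos a).2 == (pos b).1)%:R *: entry v (pos a).1 (pos b).2 -
    ((pos b).2 == (pos a).1)%:R *: entry v (pos b).1 (pos a).2.
Proof.
rewrite /entry !scaler_sumr [X in _ = X - _]big_mkcond [X in _ - X]big_mkcond -sumrB.
apply: eq_bigr => k _; rewrite /t0_const /mx_lie !mul_delta_mx_cond !val_eqE.
rewrite -(scaler_nat (_ == _)) -[X in _ - X]scaler_nat !mxE scalerBl.
congr (_ - _); case: ifP => _; case: (_ == _);
  by rewrite ?(mul1r, mul0r, scale0r, scale1r).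
Qed.

Local Notation ugen := (@ugen K _ (@t0_const n K)).

Lemma t0_bracket a b :
  ugen a * ugen b - ugen b * ugen a =
    ((pos a).2 == (pos b).1)%:R *: entry ugen (pos a).1 (pos b).2 -
    ((pos b).2 == (pos a).1)%:R *: entry ugen (pos b).1 (pos a).2.
Proof. by rewrite ugen_lie t0_const_sum. Qed.

Lemma ugen_comm a b : (pos a).2 != (pos b).1 -> (pos b).2 != (pos a).1 ->
  GRing.comm (ugen a) (ugen b).
Proof.
move=> ab ba; apply/eqP; rewrite -subr_eq0 t0_bracket (negPf ab) (negPf ba).
by rewrite !scale0r subr0.
Qed.

Lemma ugen_corner_comm k a b : (k <= n./2)%N ->
  ((pos a).1 < k)%N -> ((pos b).1 < k)%N ->
  (n - k <= (pos a).2)%N -> (n - k <= (pos b).2)%N ->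
  GRing.comm (ugen a) (ugen b).
Proof. by move=> kn a1 b1 a2 b2; apply: ugen_comm; rewrite -val_eqE /=; lia. Qed.

Lemma central_corner_det k : (k <= n./2)%N -> central (corner_det n K k).
Proof.
move=> kn; have [c cP] := corner_pos kn.
have entryc (i j : 'I_k) : entry ugen i (n - k + j) = ugen (c i j).
  by have [c1 c2] := cP i j; exact: entry_pos.
rewrite /corner_det; set M := (\matrix_(i, j) _).
have entryM i j : M i j = entry ugen i (n - k + j) by rewrite mxE.
have ME i j : M i j = ugen (c i j) by rewrite entryM entryc.
clearbody M.
apply: central_gen => a; apply/eqP; rewrite -subr_eq0; apply/eqP.
have commM i j i' j' : GRing.comm (M i j) (M i' j').
  have [c1 c2] := cP i j; have [c1' c2'] := cP i' j'.
  rewrite !ME; apply: (@ugen_corner_comm k) => //; by rewrite ?(c1, c2, c1', c2') ?leq_addr.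
have bracketM (i j : 'I_k) : ugen a * M i j - M i j * ugen a =
    ((pos a).2 == i :> nat)%:R *: entry ugen (pos a).1 (n - k + j) -
    ((n - k + j)%N == (pos a).1 :> nat)%:R *: entry ugen i (pos a).2.
  have [c1 c2] := cP i j.
  rewrite ME t0_bracket -[_ == (pos (c i j)).1]val_eqE -[_ == (pos a).1]val_eqE /=.
  by rewrite c1 c2.
have comm_eq0 (x y : uea (@t0_const n K)) : x * y - y * x = 0 -> GRing.comm x y.
  by move/eqP; rewrite subr_eq0 => /eqP.
have alt := pos_lt a; have altn := ltn_ord (pos a).2.
(* Let the unit sit at (p, q), p < q. If q < [k], the bracket turns row q into row p, which is
   another row of the corner. *)
have [ak|ka] := ltnP (pos a).2 k.
  pose i0 := Ordinal ak; pose i1 := Ordinal (ltn_trans alt ak).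
  have i01 : i0 != i1 by rewrite -val_eqE /= neq_ltn alt orbT.
  have farE (j : 'I_k) : ((n - k + j)%N == (pos a).1 :> nat) = false by lia.
  rewrite (commutator_det_row (i0 := i0)) => [|i j]; last first.
    rewrite -val_eqE /= eq_sym => /negPf ii0; apply: comm_eq0.
    by rewrite bracketM ii0 farE !scale0r subr0.
  rewrite (_ : \matrix_(i, j) _ = \matrix_(i, j) M (if i == i0 then i1 else i) j).
    apply: (eq_row_det0 i01) => [j|i j i' j']; rewrite ?mxE//.
    by rewrite eqxx eq_sym (negPf i01).
  apply/matrixP => i j; rewrite !mxE; case: eqVneq => [->|//].
  by rewrite bracketM /= eqxx farE scale1r scale0r subr0 entryM.
(* If p >= [n - k], the bracket turns the column numbered p in the full matrix into minus the one
   numbered q. *)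
have [ak|ka'] := leqP (n - k) (pos a).1.
  have j0P : ((pos a).1 - (n - k) < k)%N by lia.
  have j1P : ((pos a).2 - (n - k) < k)%N by lia.
  pose j0 := Ordinal j0P; pose j1 := Ordinal j1P.
  have i1P : ((pos a).1 < n)%N := ltn_ord _.
  have j0E : (n - k + j0 = (pos a).1)%N by rewrite /= subnKC.
  have j1E : (n - k + j1 = (pos a).2)%N by rewrite /=; lia.
  have j01 : j0 != j1 by rewrite -val_eqE /=; lia.
  have farE (i : 'I_k) : ((pos a).2 == i :> nat) = false by have := ltn_ord i; lia.
  (* Bracketing with the opposite unit absorbs that minus sign, so that the new column is exactly
     column [j1]. *)
  have opp_comm (e x : uea (@t0_const n K)) : e * x - x * e = - (- e * x - x * - e).
    by rewrite mulNr mulrN opprB opprK addrC.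
  rewrite opp_comm; apply/eqP; rewrite oppr_eq0; apply/eqP.
  rewrite (commutator_det_col (j0 := j0)) => [|i j]; last first.
    move=> jj0; apply/commr_sym/commrN/commr_sym/comm_eq0; rewrite bracketM farE scale0r.
    by rewrite -j0E eqn_add2l val_eqE (negPf jj0) scale0r subr0.
  rewrite (_ : \matrix_(i, j) _ = \matrix_(i, j) M i (if j == j0 then j1 else j)).
    by apply: (eq_col_det0 j01) => i; rewrite !mxE eqxx eq_sym (negPf j01).
  apply/matrixP => i j; rewrite !mxE; case: eqVneq => [->|//].
  rewrite mulNr mulrN opprK addrC -opprB bracketM farE j0E eqxx scale0r sub0r opprK.
  by rewrite scale1r entryM j1E.
(* In the remaining case q >= [k] and p < [n - k], so both Kronecker symbols vanish for every
   entry. *)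
rewrite comm_det ?subrr// => i j; apply: comm_eq0; rewrite bracketM.
have -> : ((pos a).2 == i :> nat) = false by have := ltn_ord i; lia.
have -> : ((n - k + j)%N == (pos a).1 :> nat) = false by have := ltn_ord i; lia.
by rewrite !scale0r subr0.
Qed.

End Envelope.

(** * Symmetrization of polynomials in commuting generators *)

Section Symmetrization.
Variables (K : numFieldType) (d : nat) (c : 'I_d -> 'I_d -> 'I_d -> K).
Implicit Types (P : mpoly.mpoly d K) (m : mpoly.multinom d).

Lemma symmetrizeE P (S : seq (mpoly.multinom d)) :
  uniq S -> {subset mpoly.msupp P <= S} ->
  symmetrize c P = \sum_(m <- S) mpoly.mcoeff m P *: sym_monomial c m.
Proof.
move=> uS sPS; rewrite [RHS](bigID (mem (mpoly.msupp P)))/= [X in _ + X]big1 => [|m].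
  rewrite addr0 -big_filter; apply: perm_big; apply: uniq_perm.
  - exact: mpoly.msupp_uniq.
  - exact: filter_uniq.
  - by move=> m; rewrite mem_filter /=; case: (boolP (m \in _)) => // /sPS ->.
by move/mpoly.memN_msupp_eq0 => ->; rewrite scale0r.
Qed.

(** The monomials may repeat or cancel, so both sides are compared over one list [S] that contains
    them all and the support of the sum. *)
Lemma symmetrize_sumX (I : finType) (a : I -> K) (m : I -> mpoly.multinom d) :
  symmetrize c (\sum_i a i *: mpoly.mpolyX K (m i)) = \sum_i a i *: sym_monomial c (m i).
Proof.
set P := (X in symmetrize _ X).
pose S := undup (mpoly.msupp P ++ [seq m i | i : I]).
have uS : uniq S by exact: undup_uniq.
rewrite (symmetrizeE uS) => [|u uP]; last by rewrite mem_undup mem_cat uP.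
transitivity (\sum_(u <- S) \sum_i (a i * (m i == u)%:R) *: sym_monomial c u).
  apply: eq_bigr => u _; rewrite -scaler_suml; congr (_ *: _).
  rewrite /P raddf_sum; apply: eq_bigr => i _.
  by rewrite /= mpoly.mcoeffZ mpoly.mcoeffX.
rewrite exchange_big; apply: eq_bigr => i _ /=.
have mS : m i \in S by rewrite mem_undup mem_cat map_f ?orbT ?mem_enum.
rewrite (bigD1_seq (m i)) //=.
rewrite eqxx mulr1 big1 ?addr0// => u /negPf; rewrite eq_sym => ->.
by rewrite mulr0 scale0r.
Qed.

(** All rearrangements of a word in commuting letters have the same product, so their average is
    that product. *)
Lemma sym_monomial_comm m (w : seq 'I_d) :
  (forall a, count_mem a w = mpoly.fun_of_multinom m a) ->
  {in w &, forall a b, GRing.comm (ugen c a) (ugen c b)} ->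
  sym_monomial c m = \prod_(a <- w) ugen c a.
Proof.
move=> mE commw; rewrite /sym_monomial; set w' := flatten _.
have ww' : perm_eq w w'.
  apply/allP => a _ /=; rewrite mE count_flatten sumnE -map_comp big_map.
  rewrite big_enum /=.
  rewrite (bigD1 a) //= count_nseq /= eqxx mul1n big1 ?addn0// => b ba.
  by rewrite count_nseq /= (negPf ba).
have commw' : {in w' &, forall a b, GRing.comm (ugen c a) (ugen c b)}.
  by move=> a b aw bw; apply: commw; rewrite (perm_mem ww').
rewrite (perm_commr_prod commw ww').
rewrite (eq_bigr (fun=> \prod_(a <- w') ugen c a)) => [|s _]; last first.
  rewrite -(big_map (fun j => tnth (in_tuple w') (s j)) xpredT (ugen c)).
  apply/esym/perm_commr_prod => //; rewrite perm_sym.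
  apply/(@tuple_permP _ _ _ (in_tuple w')); exists s.
  by rewrite /= /index_enum -enumT.
rewrite sumr_const card_Sn -(scaler_nat _ (\prod_(a <- w') ugen c a)) scalerA mulVf ?scale1r//.
Qed.

End Symmetrization.

(** * The corner minors as polynomials on the dual *)

Section CornerPolynomial.
Variables (K : numFieldType) (n : nat).

Definition corner_poly k : mpoly.mpoly (t0_dim n) K :=
  \det (\matrix_(i < k, j < k)
    entry (fun a => mpoly.mpolyX K (mpoly.mnm1 a)) i (n - k + j)).

(** Each Leibniz term is a signed monomial in commuting corner generators, which symmetrization
    leaves as the plain product. *)
Lemma symmetrize_corner_poly k : (k <= n./2)%N ->
  symmetrize (@t0_const n K) (corner_poly k) = corner_det n K k.
Proof.
move=> kn; have [c cP] := corner_pos kn.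
have entryc (T : nmodType) (v : 'I_(t0_dim n) -> T) (i j : 'I_k) :
    entry v i (n - k + j) = v (c i j).
  by have [c1 c2] := cP i j; exact: entry_pos.
pose m (s : 'S_k) := \big[@mpoly.mnm_add _/mpoly.mnm0]_i mpoly.mnm1 (c i (s i)).
transitivity (\sum_(s : 'S_k) (-1) ^+ s *: sym_monomial (@t0_const n K) (m s)).
  rewrite -symmetrize_sumX; congr symmetrize; apply: eq_bigr => s _.
  rewrite scaler_sign -mulr_sign -mpoly.mprodXE; congr (_ * _).
  by apply: eq_bigr => i _; rewrite mxE entryc.
apply: eq_bigr => s _.
rewrite (sym_monomial_comm (w := [seq c i (s i) | i <- index_enum 'I_k])).
- rewrite scaler_sign -mulr_sign; rewrite big_map /=; congr (_ * _).
  by apply: eq_bigr => i _; rewrite mxE entryc.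
- move=> a; rewrite /m mpoly.mnm_sumE count_map -sum1_count big_mkcond /=.
  by apply: eq_bigr => i _; rewrite mpoly.mnm1E; case: (_ == _).
- move=> _ _ /mapP[i _ ->] /mapP[j _ ->]; have [i1 i2] := cP i (s i).
  have [j1 j2] := cP j (s j).
  by apply: (ugen_corner_comm _ kn); rewrite ?(i1, i2, j1, j2) ?leq_addr.
Qed.

Lemma corner_polyE k x : mpoly_fun (corner_poly k) x =
  \det (\matrix_(i < k, j < k) entry (x 0) i (n - k + j)).
Proof.
rewrite /mpoly_fun /corner_poly -det_map_mx; congr determinant.
apply/matrixP => i j; rewrite !mxE raddf_sum; apply: eq_bigr => a _.
exact: mpoly.mevalXU.
Qed.

End CornerPolynomial.

(** * The rank of the coadjoint action *)

Section CoadjointRank.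

Lemma rank_sum_delta_le (F : fieldType) d (B : {set 'I_d}) :
  (\rank (\sum_(b in B) delta_mx b b : 'M[F]_d)%R <= #|B|)%N.
Proof.
rewrite -sum1_card; elim/big_ind2: _ => [|M r M' r' Mr M'r'|b _].
- by rewrite mxrank0.
- by rewrite (leq_trans (mxrank_add _ _))// leq_add.
- by rewrite mxrank_delta.
Qed.

Lemma sum_delta_setC (F : fieldType) d (B : {set 'I_d}) :
  \sum_(b in B) delta_mx b b + \sum_(b in ~: B) delta_mx b b = 1%:M :> 'M[F]_d.
Proof.
rewrite (mx1_sum_delta F d) [RHS](bigID (mem B)) /=; congr (_ + _).
by apply: eq_bigl => b; rewrite inE.
Qed.

(** Two complementary coordinate projections add up to the identity, so subadditivity of the rank
    makes both upper bounds sharp. *)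
Lemma rank_sum_delta (F : fieldType) d (B : {set 'I_d}) :
  \rank (\sum_(b in B) delta_mx b b : 'M[F]_d)%R = #|B|.
Proof.
apply/eqP; rewrite eqn_leq rank_sum_delta_le /=.
rewrite -(leq_add2r #|~: B|) cardsC card_ord -[X in (X <= _)%N](mxrank1 F).
rewrite -(sum_delta_setC F B) (leq_trans (mxrank_add _ _))// leq_add2l.
exact: rank_sum_delta_le.
Qed.

(** With [P], [Q] the projections on [B] and its complement, [P S P = 0] gives [S = P S Q + Q S],
    where each summand has rank at most that of [Q]. *)
Lemma rank_isotropic (F : fieldType) d (S : 'M[F]_d) (B : {set 'I_d}) :
  {in B &, forall a b, S a b = 0} -> (\rank S <= 2 * #|~: B|)%N.
Proof.
move=> S0; pose P : 'M[F]_d := \sum_(b in B) delta_mx b b.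
pose Q : 'M[F]_d := \sum_(b in ~: B) delta_mx b b.
have PQ : P + Q = 1%:M := sum_delta_setC F B.
have PE : P = diag_mx (\row_b (b \in B)%:R).
  rewrite diag_mx_sum_delta /P big_mkcond; apply: eq_bigr => b _; rewrite mxE.
  by case: (b \in B); rewrite ?scale1r ?scale0r.
have PSP : P *m S *m P = 0.
  rewrite PE mul_diag_mx mul_mx_diag; apply/matrixP => i j; rewrite !mxE.
  have [iB|_] := boolP (i \in B); last by rewrite !mul0r.
  by have [jB|_] := boolP (j \in B); rewrite ?mulr0// S0// mulr0 mul0r.
have -> : S = P *m S *m Q + Q *m S.
  by rewrite -[LHS]mul1mx -PQ mulmxDl -[P *m S in LHS]mulmx1 -PQ mulmxDr PSP add0r.
rewrite (leq_trans (mxrank_add _ _))// mul2n -addnn leq_add//.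
  by rewrite (leq_trans (mxrankM_maxr _ _))// rank_sum_delta.
by rewrite (leq_trans (mxrankM_maxl _ _))// rank_sum_delta.
Qed.

Variables (K : numFieldType) (n : nat).

Lemma t0_dimE : t0_dim n = 'C(n, 2).
Proof.
rewrite /t0_dim card_sig -sum1_card /= -bin2_sum big_mkord.
rewrite big_mkcond -(pair_bigA_idem _ (fun i j : 'I_n => if (i < j)%N then 1%N else 0%N)) //=.
rewrite exchange_big; apply: eq_bigr => j _ /=.
rewrite -big_mkcond (big_ord_narrow (ltnW (ltn_ord j))) sum1_card card_ord //.
Qed.

Lemma structure_mxE (x : 'rV[K]_(t0_dim n)) a b :
  structure_mx (@t0_const n K) x a b =
    ((pos a).2 == (pos b).1)%:R * entry (x 0) (pos a).1 (pos b).2 -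
    ((pos b).2 == (pos a).1)%:R * entry (x 0) (pos b).1 (pos a).2.
Proof. by rewrite mxE; exact: (@t0_const_sum n K K^o (x 0)). Qed.

Lemma antidiag_pos : exists c : 'I_n./2 -> 'I_(t0_dim n), forall k,
  (pos (c k)).1 = k :> nat /\ (pos (c k)).2 = (n - k.+1)%N :> nat.
Proof.
have /choice[c cP] : forall k : 'I_n./2, exists a : 'I_(t0_dim n),
    (pos a).1 = k :> nat /\ (pos a).2 = (n - k.+1)%N :> nat.
  by move=> k; apply: ex_pos; have := ltn_ord k; lia.
by exists c.
Qed.

(** The units in rows below m = [n./2] and columns from m on commute, so they index an isotropic set
    [B] of size m (n - m). *)
Lemma structure_mx_rank_le (x : 'rV[K]_(t0_dim n)) :
  (\rank (structure_mx (@t0_const n K) x) <= t0_dim n - n./2)%N.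
Proof.
have /choice[c cP] : forall p : 'I_n./2 * 'I_(n - n./2), exists a : 'I_(t0_dim n),
    (pos a).1 = p.1 :> nat /\ (pos a).2 = (n./2 + p.2)%N :> nat.
  by move=> p; apply: ex_pos; have := ltn_ord p.1; have := ltn_ord p.2; lia.
have c_inj : injective c.
  move=> [i j] [i' j'] cc; have [i1 j1] := cP (i, j); have [i2 j2] := cP (i', j').
  move: i1 j1; rewrite cc i2 j2 /= => ii jj.
  by congr (_, _); apply: val_inj; rewrite //=; lia.
pose B := [set c p | p in [set: 'I_n./2 * 'I_(n - n./2)]]%SET.
have cB : #|B| = (n./2 * (n - n./2))%N.
  by rewrite card_imset// cardsT card_prod !card_ord.
have := @rank_isotropic _ _ (structure_mx (@t0_const n K) x) B.
have -> : #|~: B| = (t0_dim n - n./2 * (n - n./2))%N.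
  by rewrite -cB -[X in (X - _)%N](card_ord (t0_dim n)) -(cardsC B) addKn.
move=> rk; apply: (leq_trans (rk _)) => [_ _ /imsetP[p _ ->] /imsetP[q _ ->]|].
  have [p1 p2] := cP p; have [q1 q2] := cP q; rewrite structure_mxE.
  rewrite -!(inj_eq (@ord_inj n)) p1 p2 q1 q2.
  by rewrite !gtn_eqF ?mul0r ?subr0//= ltn_addr.
rewrite t0_dimE bin2.
(* For both parities of [n], twice the codimension of the block equals [t0_dim n - n./2] exactly. *)
have nE := odd_double_half n; set m := n./2 in nE *.
have [on|en] := boolP (odd n); rewrite ?on ?(negPf en) /= in nE.
  have -> : (n * n.-1 = (m * n).*2)%N by rewrite doubleMl mulnC; congr (_ * _)%N; lia.
  rewrite doubleK -nE; nia.
have -> : (n * n.-1 = (m * n.-1).*2)%N by rewrite doubleMl; congr (_ * _)%N; lia.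
rewrite doubleK -nE; nia.
Qed.

Lemma structure_mx_rank_ge : exists x : 'rV[K]_(t0_dim n),
  (t0_dim n - n./2 <= \rank (structure_mx (@t0_const n K) x))%N.
Proof.
exists (\row_a ((pos a).1 + (pos a).2 == n.-1)%N%:R).
set x := \row_a _.
have entryx i j : entry (x 0) i j = ((i < j < n)%N && (i + j == n.-1)%N)%:R.
  have [ij|ij] /= := boolP (i < j < n)%N.
    by have [a [<- <-]] := ex_pos ij; rewrite entryE mxE.
  rewrite /entry big1 // => a /andP[/eqP ai /eqP aj]; case/negP: ij.
  by rewrite -ai -aj pos_lt ltn_ord.
pose N := [set a : 'I_(t0_dim n) | ((pos a).1 + (pos a).2 != n.-1)%N]%SET.
have cN : (t0_dim n - n./2 <= #|N|)%N.
  have [c cP] := antidiag_pos.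
  rewrite leq_subLR -[X in (X <= _)%N](card_ord (t0_dim n)) -(cardsC N) addnC leq_add2r.
  rewrite -[X in (_ <= X)%N](card_ord n./2) -[X in (_ <= X)%N]cardsT.
  apply: leq_trans (leq_imset_card c _); apply/subset_leq_card/fintype.subsetP => a.
  rewrite !inE negbK => /eqP aN; have alt := pos_lt a; have an := ltn_ord (pos a).2.
  have a1P : ((pos a).1 < n./2)%N by lia.
  apply/imsetP; exists (Ordinal a1P) => //; apply: pos_inj.
  have [c1 c2] := cP (Ordinal a1P).
  rewrite [LHS]surjective_pairing [RHS]surjective_pairing.
  by congr (_, _); apply: ord_inj; rewrite ?c1 ?c2 //=; lia.
apply: (leq_trans cN); rewrite -(rank_sum_delta K N); apply: mxrankS.
set S := structure_mx _ _; set P := \sum_(b in N) _.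
have PE a : row a P = (a \in N)%:R *: delta_mx 0 a.
  apply/rowP => b; rewrite !mxE summxE big_mkcond (bigD1 a) //= big1 => [|k ka].
    by case: (a \in N); rewrite ?mxE ?eqxx ?mul1r ?mul0r addr0 // eq_sym.
  by case: ifP => // _; rewrite mxE eq_sym (negPf ka).
(* The row that isolates the unit (i, j), in 0-based numbering, is that of (j, n-1-i) if i + j <
   n-1, and that of (n-1-j, i) if i + j > n-1. A nonzero entry from the other half of the bracket
   would force j < i. *)
have SP a : a \in N -> exists b s, row b S = s *: delta_mx 0 a /\ s != 0 :> K.
  rewrite inE => aN; have alt := pos_lt a; have an := ltn_ord (pos a).2.
  have [lt|ge] := ltnP ((pos a).1 + (pos a).2) n.-1.
    have [|b [b1 b2]] := @ex_pos n (pos a).2 (n.-1 - (pos a).1); first lia.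
    exists b, (-1); split; last by rewrite oppr_eq0 oner_eq0.
    apply/rowP => a'; rewrite [LHS]mxE structure_mxE !entryx !mxE /= b1 b2 [a' == a]eq_pos.
    rewrite -!(inj_eq (@ord_inj n)) b1 b2 -!natrM !mulnb mulN1r.
    have a'lt := pos_lt a'; have a'n := ltn_ord (pos a').2.
    rewrite [X in X%:R - _](_ : _ = 0%N); last by apply/eqP; rewrite eqb0; lia.
    by rewrite sub0r; congr (- (nat_of_bool _)%:R); lia.
  have [|b [b1 b2]] := @ex_pos n (n.-1 - (pos a).2) (pos a).1; first lia.
  exists b, 1; split; last exact: oner_neq0.
  apply/rowP => a'; rewrite [LHS]mxE structure_mxE !entryx !mxE /= b1 b2 [a' == a]eq_pos.
  rewrite -!(inj_eq (@ord_inj n)) b1 b2 -!natrM !mulnb mul1r.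
  have a'lt := pos_lt a'; have a'n := ltn_ord (pos a').2.
  rewrite [X in _ - X%:R](_ : _ = 0%N); last by apply/eqP; rewrite eqb0; lia.
  by rewrite subr0; congr ((nat_of_bool _)%:R); lia.
apply/row_subP => a; rewrite PE; have [aN|aN] := boolP (a \in N); last first.
  by rewrite scale0r sub0mx.
have [b [s [Sb s0]]] := SP _ aN.
by rewrite scale1r -(scalerK s0 (delta_mx 0 a)) -Sb scalemx_sub// row_sub.
Qed.

Lemma num_invariants_t0 : num_invariants (@t0_const n K) = n./2.
Proof.
(* Subtraction on [nat] is truncated; this bound is what makes [t0_dim n - (t0_dim n - n./2)] equal
   to [n./2]. *)
have n2d : (n./2 <= t0_dim n)%N.
  have [c cP] := antidiag_pos.
  rewrite -[X in (X <= _)%N]card_ord -[X in (_ <= X)%N]card_ord.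
  apply: (leq_card c) => i j cc; apply: val_inj.
  have [ci _] := cP i; have [cj _] := cP j.
  by have := congr1 (fun a => nat_of_ord (pos a).1) cc; rewrite /= ci cj.
suff -> : num_invariants (@t0_const n K) = (t0_dim n - (t0_dim n - n./2))%N.
  by rewrite subKn.
congr (_ - _)%N; apply/eqP; rewrite eqn_leq; apply/andP; split.
  apply/bigmax_leqP => r /asboolP[x <-]; exact: structure_mx_rank_le.
have [x xr] := structure_mx_rank_ge.
apply: leq_trans xr _.
have rP : (\rank (structure_mx (@t0_const n K) x) < (t0_dim n).+1)%N.
  by rewrite ltnS rank_leq_row.
apply: (@leq_bigmax_cond _ _ (fun r : 'I_(t0_dim n).+1 => nat_of_ord r) (Ordinal rP)).
by apply/asboolP; exists x.
Qed.

End CoadjointRank.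

(** * Invariance of the minors under the unitriangular group *)

Section CoadjointInvariance.
Variables (K : numFieldType) (n : nat).
Implicit Types (g : 'M[K]_n) (x : 'rV[K]_(t0_dim n)).

Lemma ord_ltF m (i j : 'I_m) : (i < j)%N -> (i == j) = false.
Proof. by move=> ij; apply/eqP => ji; move: ij; rewrite ji ltnn. Qed.

Lemma ord_gtF m (i j : 'I_m) : (j < i)%N -> (i == j) = false.
Proof. by rewrite eq_sym; exact: ord_ltF. Qed.

Lemma unitriangularE g (i j : 'I_n) :
  unitriangular g -> (j <= i)%N -> g i j = (i == j)%:R.
Proof. by move=> gU; exact: gU. Qed.

Lemma unitriangular_unit g : unitriangular g -> g \in unitmx.
Proof.
move=> gU; rewrite unitmxE -det_tr det_trig => [|]; last first.
  by apply/is_trig_mxP => i j ij; rewrite mxE (unitriangularE gU (ltnW ij)) ord_gtF.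
by rewrite big1 ?unitr1// => i _; rewrite mxE (unitriangularE gU)// eqxx.
Qed.

(** Row i of [g *m invmx g = 1] gives row i of the inverse from the rows below it: induction from
    the last row upward, with [d] bounding [n - i]. *)
Lemma unitriangular_inv g : unitriangular g -> unitriangular (invmx g).
Proof.
move=> gU; have gV := mulmxV (unitriangular_unit gU).
suff inv_entry d : forall i j : 'I_n, (n - i <= d)%N -> (j <= i)%N ->
    invmx g i j = (i == j)%:R.
  by move=> i j ji; apply: (inv_entry n) => //; rewrite leq_subr.
elim: d => [|d IHd] i j id ji; first by have := ltn_ord i; lia.
have /matrixP/(_ i j) := gV; rewrite !mxE (bigD1 i) //= (unitriangularE gU)// eqxx mul1r.
rewrite big1 ?addr0// => l li; have [il|il] := ltnP i l.
  rewrite IHd ?(leq_trans ji (ltnW il))//; last by lia.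
  by rewrite ord_gtF ?mulr0// (leq_ltn_trans ji).
by rewrite (unitriangularE gU)// eq_sym (negPf li) mul0r.
Qed.

Lemma coAdE g x a : coAd g x 0 a =
  \sum_b x 0 b * (invmx g (pos b).1 (pos a).1 * g (pos a).2 (pos b).2).
Proof.
rewrite mxE; apply: eq_bigr => b _; congr (_ * _).
rewrite mxE (bigD1 (pos a).2) //= big1 ?addr0 => [|j ja]; rewrite !mxE.
  rewrite (bigD1 (pos a).1) //= big1 ?addr0 => [|i ia]; rewrite mxE eqxx.
    by rewrite eqxx mulr1.
  by rewrite (negPf ia) mulr0.
by rewrite big1 ?mul0r// => i _; rewrite mxE (negPf ja) andbF mulr0.
Qed.

(** By triangularity the coordinate at (i, j) of [coAd g x] involves only units (p, q) with p <= i
    and q >= j, all inside the corner. The corner block thus becomes [P X Q], with [P], [Q] the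
    transposes of the leading block of [invmx g] and the trailing block of [g]. *)
Lemma corner_poly_invariant k : (k <= n./2)%N ->
  coAd_invariant setT (mpoly_fun (corner_poly K n k)).
Proof.
move=> kn x A _ AU _ _ g /AU gU {A AU}; have hU := unitriangular_inv gU.
have [c cP] := corner_pos kn.
have entryc (T : nmodType) (v : 'I_(t0_dim n) -> T) (i j : 'I_k) :
    entry v i (n - k + j) = v (c i j).
  by have [c1 c2] := cP i j; exact: entry_pos.
have rowP (i : 'I_k) : (i < n)%N by have := ltn_ord i; lia.
have colP (j : 'I_k) : (n - k + j < n)%N by have := ltn_ord j; lia.
pose row i := Ordinal (rowP i); pose col j := Ordinal (colP j).
have posc i j : pos (c i j) = (row i, col j).
  have [c1 c2] := cP i j; rewrite [LHS]surjective_pairing.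
  by congr (_, _); apply: ord_inj; rewrite ?c1 ?c2.
rewrite !corner_polyE.
pose P := \matrix_(i < k, p < k) invmx g (row p) (row i).
pose Q := \matrix_(q < k, j < k) g (col j) (col q).
have detP : \det P = 1.
  rewrite det_trig => [|]; last first.
    apply/is_trig_mxP => i p ip; have rip : (row i < row p)%N by [].
    by rewrite mxE (unitriangularE hU (ltnW rip)) ord_gtF.
  by rewrite big1 // => i _; rewrite mxE (unitriangularE hU)// eqxx.
have detQ : \det Q = 1.
  rewrite det_trig => [|]; last first.
    apply/is_trig_mxP => q j qj; rewrite mxE.
    have cqj : (col q < col j)%N by rewrite ltn_add2l.
    by rewrite (unitriangularE gU (ltnW cqj)) (ord_gtF cqj).
  by rewrite big1 // => j _; rewrite mxE (unitriangularE gU)// eqxx.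
rewrite -[RHS]mul1r -[RHS]mulr1 -{1}detP -detQ -!det_mulmx; congr determinant.
apply/matrixP => i j; rewrite mxE entryc coAdE posc /=.
have c_inj : injective (fun p => c p.1 p.2).
  move=> [p q] [p' q'] /= /(congr1 (@pos n)); rewrite !posc => -[] pp.
  by move=> /addnI qq; congr (_, _); apply: ord_inj.
rewrite (bigID (mem [set c p.1 p.2 | p in [set: 'I_k * 'I_k]]%SET)) /=.
rewrite [X in _ + X]big1 => [|b]; last first.
  move=> bc; suff: (i < (pos b).1)%N || ((pos b).2 < n - k + j)%N.
    case/orP => [ib|bj]; last first.
      by rewrite (unitriangularE gU (ltnW bj : (_ <= col j)%N)) ord_gtF// !mulr0.
    by rewrite (unitriangularE hU (ltnW ib : (row i <= _)%N)) ord_gtF//= mul0r mulr0.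
  apply: contraR bc; rewrite negb_or -!leqNgt => /andP[b1 b2].
  have b1P : ((pos b).1 < k)%N by rewrite (leq_ltn_trans b1).
  have b2P : ((pos b).2 - (n - k) < k)%N by have := ltn_ord (pos b).2; lia.
  apply/imsetP; exists (Ordinal b1P, Ordinal b2P); first by rewrite inE.
  apply: (@pos_inj n).
  rewrite posc [LHS]surjective_pairing; congr (_, _); apply: ord_inj => //=.
  lia.
rewrite addr0 big_imset /= => [|p q _ _]; last exact: c_inj.
rewrite mxE [RHS](eq_bigr (fun q : 'I_k =>
    \sum_(p < k) P i p * entry (x 0) p (n - k + q) * Q q j)).
  rewrite exchange_big pair_big_dep; apply: eq_big => [p|p _]; first by rewrite inE.
  by rewrite entryc !posc !mxE /= mulrCA mulrA.
move=> q _; rewrite mxE mulr_suml; apply: eq_bigr => p _.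
by congr (_ * _ * _); rewrite mxE.
Qed.

End CoadjointInvariance.

(** * Smoothness and analyticity of polynomial functions *)

Section PolynomialFunctions.
Variables (K : numFieldType) (d : nat).
Implicit Types (P Q : mpoly.mpoly d K) (x v : 'rV[K]_d).

Lemma mpoly_ring_ind (T : mpoly.mpoly d K -> Prop) :
  (forall c, T (mpoly.mpolyC d c)) -> (forall i, T (mpoly.mpolyX K (mpoly.mnm1 i))) ->
  (forall P Q, T P -> T Q -> T (P + Q)) -> (forall P Q, T P -> T Q -> T (P * Q)) ->
  forall P, T P.
Proof.
move=> TC TX TD TM P; rewrite (mpoly.mpolyE P); apply: big_ind => [|//|m _].
  by rewrite -mpoly.mpolyC0; exact: TC.
rewrite -mpoly.mul_mpolyC; apply: (TM _ _ (TC _)); rewrite mpoly.mpolyXE_id.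
apply: big_ind => [|//|i _]; first by rewrite -mpoly.mpolyC1; exact: TC.
elim: (mpoly.fun_of_multinom m i) => [|k IHk].
  by rewrite expr0 -mpoly.mpolyC1; exact: TC.
by rewrite exprS; exact: TM.
Qed.

Lemma mpoly_funC (c : K) : mpoly_fun (mpoly.mpolyC d c) = cst c.
Proof. by apply/funext => x; rewrite /mpoly_fun mpoly.mevalC. Qed.

Lemma mpoly_funX i :
  mpoly_fun (mpoly.mpolyX K (mpoly.mnm1 i)) = (fun x : 'rV[K]_d => x 0 i).
Proof. by apply/funext => x; rewrite /mpoly_fun mpoly.mevalXU. Qed.

Lemma mpoly_funD P Q : mpoly_fun (P + Q) = mpoly_fun P + mpoly_fun Q.
Proof. by apply/funext => x; rewrite /mpoly_fun mpoly.mevalD. Qed.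

Lemma mpoly_funM P Q : mpoly_fun (P * Q) = mpoly_fun P * mpoly_fun Q.
Proof. by apply/funext => x; rewrite /mpoly_fun mpoly.mevalM. Qed.

Lemma mpoly_fun_continuous P : continuous (mpoly_fun P).
Proof.
elim/mpoly_ring_ind: P => [c|i|P Q cP cQ|P Q cP cQ] x.
- rewrite mpoly_funC; exact: cst_continuous.
- rewrite mpoly_funX; exact: coord_continuous.
- rewrite mpoly_funD; apply: continuousD; [exact: cP|exact: cQ].
- rewrite mpoly_funM; apply: continuousM; [exact: cP|exact: cQ].
Qed.

(** The difference quotient is constant for [h != 0]. *)
Lemma is_derive_affine (f : 'rV[K]_d -> K) x v c :
  (forall h, f (h *: v + x) = f x + h * c) -> is_derive x v f c.
Proof.
move=> fE.
have fc : (fun h => h^-1 *: ((f \o shift x) (h *: v) - f x)) @ 0^' --> c.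
  apply: cvg_near_cst; near=> h.
  rewrite /= fE addrAC subrr add0r; apply/mulKf; near: h.
  exact: nbhs_dnbhs_neq.
split; first by apply/cvg_ex; exists c.
exact: cvg_lim fc.
Unshelve. all: by end_near. Qed.

Lemma mpoly_fun_is_derive P x i :
  is_derive x (delta_mx 0 i) (mpoly_fun P) (mpoly_fun (mpoly.mderiv i P) x).
Proof.
elim/mpoly_ring_ind: P => [c|j|P Q dP dQ|P Q dP dQ].
- rewrite mpoly_funC mpoly.mderivC -mpoly.mpolyC0 mpoly_funC; exact: is_derive_cst.
- apply: is_derive_affine => h; rewrite mpoly_funX !mxE eqxx /= mpoly.mderivX.
  rewrite /mpoly_fun mpoly.mevalZ mpoly.mnm1E [RHS]addrC eq_sym; congr (h * _ + _).
  case: eqP => [->|_]; last by rewrite mul0r.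
  rewrite (_ : mpoly.mnm_sub _ _ = mpoly.mnm0).
    by rewrite mul1r mpoly.mpolyX0 mpoly.meval1.
  by apply/mpoly.mnmP => k; rewrite mpoly.mnmBE mpoly.mnm0E subnn.
- rewrite mpoly.mderivD !mpoly_funD; exact: is_deriveD.
- rewrite mpoly.mderivM !(mpoly_funD, mpoly_funM).
  apply: is_derive_eq. rewrite /= addrC; congr (_ + _). exact: mulrC.
Qed.

Lemma mpoly_fun_smooth P : smooth_on setT (mpoly_fun P).
Proof.
move=> r; elim: r P => [|r IHr] P.
  by split=> // x _; exact: mpoly_fun_continuous.
split=> [x _|i]; first exact: mpoly_fun_continuous.
split=> [x _|]; first exact: (@ex_derive _ _ _ _ _ _ _ (mpoly_fun_is_derive P x i)).
rewrite (_ : (fun x => _) = mpoly_fun (mpoly.mderiv i P)); first exact: IHr.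
by apply/funext => x; exact: (@derive_val _ _ _ _ _ _ _ (mpoly_fun_is_derive P x i)).
Qed.

Lemma mpoly_fun_analytic P : analytic_on setT (mpoly_fun P).
Proof.
move=> a _.
(* The Taylor coefficients of [P] at [a] are the coefficients of the translate [Q]. Radius 1 with
   the sum of their norms as bound gives the Cauchy estimate, and the partial sums are stationary
   beyond the degree. *)
pose X i : mpoly.mpoly d K := mpoly.mpolyX K (mpoly.mnm1 i).
pose Q := mpoly.comp_mpoly [tuple X i + mpoly.mpolyC d (a 0 i) | i < d] P.
have QE h : mpoly_fun Q h = mpoly_fun P (a + h).
  rewrite /mpoly_fun mpoly.comp_mpoly_meval; apply: mpoly.meval_eq => i.
  by rewrite tnth_mktuple mpoly.mevalD mpoly.mevalXU mpoly.mevalC mxE addrC.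
exists (fun m => mpoly.mcoeff m Q), 1, (\sum_(m <- mpoly.msupp Q) `|mpoly.mcoeff m Q|).
split=> [//|m|h _].
  rewrite expr1n mulr1; have [mQ|mQ] := boolP (m \in mpoly.msupp Q).
    by rewrite (bigD1_seq m) ?mpoly.msupp_uniq//= lerDl sumr_ge0.
  by rewrite mpoly.memN_msupp_eq0// normr0 sumr_ge0.
apply: cvg_near_cst; exists (mpoly.mmeasure (@mpoly.mdeg d) Q) => // N /= QN.
rewrite -QE /mpoly_fun [in RHS](mpoly.mpolywE QN) raddf_sum; apply: eq_bigr => m _.
by rewrite /= mpoly.mevalZ mpoly.mevalX.
Qed.

End PolynomialFunctions.

(** * Density of nonvanishing points and independence of the minors *)

Section FunctionalIndependence.
Variable K : numFieldType.

Lemma mpoly_fun_line d (P : mpoly.mpoly d K) (x z : 'rV[K]_d) :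
  exists q : {poly K}, forall t, q.[t] = mpoly_fun P (x + t *: z).
Proof.
elim/mpoly_ring_ind: P => [c|i|P Q [p pE] [q qE]|P Q [p pE] [q qE]].
- by exists c%:P => t; rewrite mpoly_funC hornerC.
- by exists ((x 0 i)%:P + 'X * (z 0 i)%:P) => t; rewrite mpoly_funX !hornerE !mxE.
- by exists (p + q) => t; rewrite mpoly_funD hornerD pE qE.
- by exists (p * q) => t; rewrite mpoly_funM hornerM pE qE.
Qed.

(** On the line from a point of [W] to [y] the function is a univariate polynomial, nonzero at
    parameter 1; its finitely many roots cannot exhaust the part of the line in [W]. *)
Lemma mpoly_fun_neq0_open d (P : mpoly.mpoly d K) (y : 'rV[K]_d) (W : set 'rV[K]_d) :
  open W -> W !=set0 -> mpoly_fun P y != 0 -> exists2 x, W x & mpoly_fun P x != 0.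
Proof.
move=> oW [x Wx] Py; have [q qE] := mpoly_fun_line P x (y - x).
have q0 : q != 0.
  by apply: contraNneq Py => q0; rewrite -(subrK x y) addrC -[y - x]scale1r -qE q0 horner0.
have : \forall t \near (0 : K), W (x + t *: (y - x)).
  have ct : {for 0, continuous (fun t : K => x + t *: (y - x))}.
    apply: continuousD; first exact: cst_continuous.
    by apply: continuousZr_tmp.
  by apply: ct; rewrite scale0r addr0; exact: open_nbhs_nbhs.
move=> /nbhs_ballP[e /= e0 eW].
(* These are [size q] distinct parameters, more than [q] has roots; dividing by at least 2 keeps
   them inside the open ball of radius [e]. *)
pose rs := [seq e / (i.+2)%:R | i <- iota 0 (size q)].
have urs : uniq rs.
  rewrite map_inj_uniq ?iota_uniq// => i j /(mulfI (lt0r_neq0 e0)).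
  by move/invr_inj/eqP; rewrite eqr_nat => /eqP[].
have : ~~ all (root q) rs.
  apply/negP => /(max_poly_roots q0)/(_ urs).
  by rewrite size_map size_iota ltnn.
case/allPn => _ /mapP[i _ ->] qi; exists (x + (e / i.+2%:R) *: (y - x)).
  apply: eW; rewrite /ball /= sub0r normrN.
  by rewrite gtr0_norm ?divr_gt0 ?ltr0n// ltr_pdivrMr ?ltr0n// ltr_pMr// ltr1n.
by rewrite -qE.
Qed.

(** At the antidiagonal point the corner block is the matrix of the order-reversing permutation,
    with determinant plus or minus 1. *)
Lemma corner_poly_antidiag n k : (k <= n./2)%N ->
  mpoly_fun (corner_poly K n k) (\row_a ((pos a).1 + (pos a).2 == n.-1)%N%:R) != 0.
Proof.
move=> kn; have [c cP] := corner_pos kn.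
rewrite corner_polyE (_ : \matrix_(i, j) _ = perm_mx (perm (@rev_ord_inj k))).
  by rewrite det_perm signr_eq0.
apply/matrixP => i j; rewrite !mxE permE; have [c1 c2] := cP i j.
rewrite (entry_pos _ c1 c2) mxE c1 c2 -val_eqE /=.
by congr ((nat_of_bool _)%:R); have := ltn_ord i; have := ltn_ord j; lia.
Qed.

Lemma corner_functionally_independent n :
  functionally_independent setT (fun k : 'I_n./2 => mpoly_fun (corner_poly K n k.+1)).
Proof.
move=> W oW _ W0; pose P := \prod_(k < n./2) corner_poly K n k.+1.
have PE x : mpoly_fun P x = \prod_(k < n./2) mpoly_fun (corner_poly K n k.+1) x.
  exact: rmorph_prod.
pose y : 'rV[K]_(t0_dim n) := \row_a ((pos a).1 + (pos a).2 == n.-1)%N%:R.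
have [|x Wx] := @mpoly_fun_neq0_open _ P y W oW W0.
  by rewrite PE; apply/prodf_neq0 => k _; exact: corner_poly_antidiag.
rewrite PE => /prodf_neq0 Px; exists x => //.
(* Order 0 is included, where the empty minor is 1: it is the first diagonal entry of the
   Jacobian. *)
have Fx k : (k <= n./2)%N -> mpoly_fun (corner_poly K n k) x != 0.
  case: k => [_|k kn]; last by have := Px (Ordinal kn) isT.
  by rewrite corner_polyE det_mx00 oner_neq0.
have [c cP] := antidiag_pos n.
set J := Defs.jacobian _ x.
have dF (k : 'I_n./2) b dk :
    (forall h, mpoly_fun (corner_poly K n k.+1) (h *: delta_mx 0 b + x) =
       mpoly_fun (corner_poly K n k.+1) x + h * dk) -> J k b = dk.
  move=> /(@is_derive_affine K) dk_der; rewrite mxE.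
  exact: (@derive_val _ _ _ _ _ _ _ dk_der).
(* The antidiagonal coordinate of index [k'] sits in the block of order [k.+1] at row [k'], column
   [k - k']. If [k' > k] that difference truncates to 0, but no row [i] equals [k'], so the block is
   unchanged. *)
have entryD (k k' : 'I_n./2) h (i j : 'I_k.+1) :
    entry ((h *: delta_mx 0 (c k') + x) 0) i (n - k.+1 + j) =
    entry (x 0) i (n - k.+1 + j) + h * ((i == k' :> nat) && (j == k - k' :> nat)%N)%:R.
  have kn := ltn_ord k; have := corner_pos kn => -[b bP]; have [b1 b2] := bP i j.
  have [c1 c2] := cP k'.
  rewrite !(entry_pos _ b1 b2) !mxE eqxx addrC; congr (_ + _ * (nat_of_bool _)%:R).
  rewrite /= eq_pos b1 b2 c1 c2; have := ltn_ord i; have := ltn_ord j; have := ltn_ord k'.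
  lia.
pose A := \matrix_(k < n./2, k' < n./2) J k (c k').
have Atrig : is_trig_mx A.
  apply/is_trig_mxP => k k' kk'; rewrite mxE; apply: dF => h.
  rewrite mulr0 addr0 !corner_polyE; congr determinant.
  apply/matrixP => i j; rewrite !mxE entryD.
  by rewrite ltn_eqF ?mulr0 ?addr0// (leq_trans (ltn_ord i)).
(* Index [k] is the bottom left entry of its block, so the derivative is the cofactor there: up to
   sign, the corner minor of order [k]. *)
have Adiag k : A k k != 0.
  pose M := \matrix_(i < k.+1, j < k.+1) entry (x 0) i (n - k.+1 + j).
  rewrite mxE (dF _ _ (cofactor M ord_max ord0)) => [|h].
    rewrite /cofactor mulf_neq0 ?signr_eq0//.
    have -> : row' ord_max (col' ord0 M) =
        \matrix_(i < k, j < k) entry (x 0) i (n - k + j).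
      apply/matrixP => i j; rewrite !mxE; congr entry.
        by rewrite /= /bump leqNgt ltn_ord.
      by rewrite /= /bump; have := ltn_ord k; lia.
    by rewrite -corner_polyE; exact: Fx (ltnW (ltn_ord k)).
  rewrite !corner_polyE -/M; set Mh := (X in \det X = _).
  have MhE i j : Mh i j = M i j + h * ((i == k :> nat) && (j == 0 :> nat)%N)%:R.
    by rewrite !mxE entryD subnn.
  have cofE j : cofactor Mh ord_max j = cofactor M ord_max j.
    congr (_ * \det _); apply/matrixP => i l; rewrite 2!mxE [RHS]mxE [in RHS]mxE MhE.
    have -> : (lift ord_max i == k :> nat) = false.
      by apply/negbTE; rewrite eq_sym neq_bump.
    by rewrite mulr0 addr0.
  rewrite (expand_det_row _ ord_max) (expand_det_row M ord_max).
  rewrite (bigD1 ord0) //= [in RHS](bigD1 ord0) //= addrAC !cofE MhE !eqxx mulr1 mulrDl.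
  congr (_ + _); apply: eq_bigr => j j0; rewrite cofE MhE.
  by rewrite [X in _ && X](_ : _ = false) ?andbF ?mulr0 ?addr0//; exact: negPf.
have Aunit : A \in unitmx.
  by rewrite unitmxE (det_trig Atrig) unitfE; apply/prodf_neq0 => k _.
apply/eqP; change (row_free J); apply/row_freeP.
(* [N] selects the antidiagonal columns, so inverting [A] yields a right inverse of [J]. *)
pose N : 'M[K]_(t0_dim n, n./2) := \matrix_(b, k) (b == c k)%:R.
exists (N *m invmx A); rewrite mulmxA (_ : J *m N = A) ?mulmxV//.
apply/matrixP => k k'; rewrite [LHS]mxE [RHS]mxE (bigD1 (c k')) //=.
rewrite [N _ _]mxE eqxx mulr1 big1 ?addr0// => b bc.
by rewrite [N _ _]mxE (negPf bc) mulr0.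
Qed.

End FunctionalIndependence.

(** * Connectedness of the dual space *)

Section Connected.

(** The space is star-shaped about 0. The path [phi] from 0 to 1 in the scalars brings the real unit
    interval into [K], which covers real and complex scalars alike. *)
Lemma rV_connected (R : realType) (K : numFieldType) (phi : R -> K) d :
  continuous phi -> phi 0 = 0 -> phi 1 = 1 -> connected [set: 'rV[K]_d].
Proof.
move=> cphi phi0 phi1.
rewrite (_ : setT = \bigcup_(x in [set: 'rV[K]_d]) ((fun t => phi t *: x) @` `[0, 1])).
  apply: bigcup_connected => [|x _].
    exists 0 => x _; exists 0; rewrite ?phi0 ?scale0r//=.
    by rewrite in_itv /= lexx ler01.
  apply: connected_continuous_connected; first exact: segment_connected.
  apply: continuous_subspaceT => t; apply: continuousZr_tmp. exact: cphi.
rewrite eqEsubset; split=> // x _; exists x => //; exists 1; last by rewrite phi1 scale1r.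
by rewrite /= in_itv /= lexx ler01.
Qed.

Lemma complex_rV_connected (R : realType) d :
  connected [set: 'rV[(R[i]%C : numFieldType)]_d].
Proof.
apply: (@rV_connected R R[i]%C (fun t => (t%:C)%C)) => // t.
(* A positive element of [R[i]] has zero imaginary part, so the complex tolerance is a real one. *)
apply/cvgrPdist_lt => -[a b]; rewrite ltcE /= => /andP[/eqP -> a0].
near=> s.
rewrite -rmorphB /= normc_def /= expr0n addr0 sqrtr_sqr ltcE /= eqxx /=.
near: s; apply: cvgr_dist_lt a0; exact: cvg_id.
Unshelve. all: by end_near. Qed.

End Connected.

Theorem theorem1 (R : realType) (n : nat) (hn : (2 <= n)%N) :
  Casimir_basis smooth_on (fun k : 'I_(n./2) => corner_det n R k.+1) /\
  Casimir_basis analytic_on (fun k : 'I_(n./2) => corner_det n R[i]%C k.+1).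
Proof.
(* The algebra is uniform in the field; only regularity of polynomial functions and connectedness of
   the dual are checked for each field. *)
have Casimir (K : numFieldType) regular :
    (forall P : mpoly.mpoly (t0_dim n) K, regular setT (mpoly_fun P)) ->
    connected [set: 'rV[K]_(t0_dim n)] ->
    Casimir_basis regular (fun k : 'I_(n./2) => corner_det n K k.+1).
  move=> reg conn; split=> [k|]; first exact: central_corner_det.
  exists (fun k => corner_poly K n k.+1); split=> [k|].
    by rewrite symmetrize_corner_poly.
  split; first by split=> //; [exact: openT | exists 0].
  split=> [|k|]; [by rewrite num_invariants_t0 | | exact: corner_functionally_independent].
  by split; [exact: reg | exact: corner_poly_invariant].
split; apply: Casimir.
- exact: mpoly_fun_smooth.
- by apply: (@rV_connected R R id) => // x; exact: cvg_id.
- exact: mpoly_fun_analytic.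
- exact: complex_rV_connected.
Qed.
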